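(* Let $K\to R$ be a homomorphism of commutative rings, and let $R\to S_l$, $1\le l\le n$, be a finite collection of homomorphisms of commutative rings such that the collection of induced maps of the spectra $\mathrm{Spec}\,S_l\to\mathrm{Spec}\,R$ is an affine open covering of the affine scheme $\mathrm{Spec}\,R$. Let $\alpha$ be an ordinal. Let $U$ and $V$ be two $R$-modules, and let $D_l\colon S_l\otimes_RU\to S_l\otimes_RV$ be $K$-linear quite $S_l$-differential operators of ordinal order at most $\alpha$, defined for all indices $1\le l\le n$. For every pair of indices $j$ and $l$, put $S_{jl}=S_j\otimes_RS_l$. Assume that, for every pair of indices $j$ and $l$, the quite $S_{jl}$-differential operator $D_{jl}\colon S_{jl}\otimes_RU\to S_{jl}\otimes_RV$ induced by $D_l$ is equal (under the identification $S_{jl}\simeq S_{lj}$) to the quite $S_{lj}$-differential operator $D_{lj}\colon S_{lj}\otimes_RU\to S_{lj}\otimes_RV$ induced by $D_j$. Then there exists a unique $K$-linear quite $R$-differential operator $D\colon U\to V$ of ordinal order at most $\alpha$ such that, for every index $l$, the quite $S_l$-differential operator $D_l$ is induced by $D$.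
   Context: For a homomorphism of commutative rings $K\to R$ and $R$-modules $U$, $V$, the group $E=\mathrm{Hom}_K(U,V)$ is an $R$-$R$-bimodule: $(re)(u)=r\,e(u)$, $(er)(u)=e(ru)$. Define $F_0E=\{e\in E\mid re-er=0\ \forall r\in R\}$ and $F_\alpha E=\{e\in E\mid re-er\in\bigcup_{\beta<\alpha}F_\beta E\ \forall r\in R\}$ for every ordinal $\alpha>0$. A $K$-linear map $e\colon U\to V$ is a $K$-linear quite $R$-differential operator of ordinal order at most $\alpha$ if $e\in F_\alpha E$; it is a quite $R$-differential operator if this holds for some ordinal $\alpha$. Induced operators: if $A\to A'$ is a flat epimorphism of commutative $K$-algebras (an epimorphism in commutative rings with $A'$ flat over $A$), $M$, $N$ are $A$-modules and $D\colon M\to N$ is a $K$-linear quite $A$-differential operator, then there is a unique $K$-linear quite $A'$-differential operator $D'\colon A'\otimes_AM\to A'\otimes_AN$ with $D'(1\otimes m)=1\otimes D(m)$ for all $m\in M$; it is said to be induced by $D$. This is applied to $R\to S_l$ and to $S_l\to S_{jl}$, $S_j\to S_{jl}$, with the identifications $S_{jl}\otimes_{S_l}(S_l\otimes_RU)=S_{jl}\otimes_RU$, etc. An affine open covering means that every $\mathrm{Spec}\,S_l\to\mathrm{Spec}\,R$ is an open immersion and the images cover $\mathrm{Spec}\,R$ (so $R\to S_l$ are flat epimorphisms). *)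

(* Defs.v *)
From HB Require Import structures.
From mathcomp Require Import all_boot all_order all_algebra.
From mathcomp Require Import mathcomp_extra boolp classical_sets.
From mathcomp Require Import topology.

Set Implicit Arguments.
Unset Strict Implicit.
Unset Printing Implicit Defensive.

Import Order.TTheory GRing.Theory.

Local Open Scope ring_scope.
Local Open Scope quotient_scope.

(* Zero rings must be allowed (e.g. S_j (x)_R S_l for disjoint open pieces),  *)
(* hence comPzRingType rather than comNzRingType throughout.                  *)

Section TensorProduct.
Variables (R : comPzRingType) (M N : lmodType R).

(* The sequence [:: (m1, n1); ...; (mk, nk)] stands for the formal sum        *)
(* m1 (x) n1 + ... + mk (x) nk; opposites are (- m) (x) n.                    *)
Inductive tens_rel : seq (M * N) -> seq (M * N) -> Prop :=
| tens_refl x : tens_rel x x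
| tens_sym x y : tens_rel x y -> tens_rel y x
| tens_trans y x z : tens_rel x y -> tens_rel y z -> tens_rel x z
| tens_cat x x' y y' :
    tens_rel x x' -> tens_rel y y' -> tens_rel (x ++ y) (x' ++ y')
| tens_catC x y : tens_rel (x ++ y) (y ++ x)
| tens_zero n : tens_rel [:: (0, n)] [::]
| tens_addl m m' n : tens_rel [:: (m + m', n)] [:: (m, n); (m', n)]
| tens_addr m n n' : tens_rel [:: (m, n + n')] [:: (m, n); (m, n')]
| tens_bal (r : R) m n : tens_rel [:: (r *: m, n)] [:: (m, r *: n)].

Definition tens_relb (x y : seq (M * N)) : bool := `[< tens_rel x y >].

Fact tens_relb_refl : reflexive tens_relb.
Proof. by move=> x; apply/asboolP; exact: tens_refl. Qed.

Fact tens_relb_sym : symmetric tens_relb.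
Proof. by move=> x y; apply/asboolP/asboolP; exact: tens_sym. Qed.

Fact tens_relb_trans : transitive tens_relb.
Proof.
by move=> y x z /asboolP xy /asboolP yz; apply/asboolP; exact: tens_trans yz.
Qed.

Canonical tens_equiv :=
  EquivRel tens_relb tens_relb_refl tens_relb_sym tens_relb_trans.

Definition tensor : Type := {eq_quot tens_equiv}.

HB.instance Definition _ := Choice.on tensor.
HB.instance Definition _ := EqQuotient.on tensor.

Lemma tensor_piP (x y : seq (M * N)) :
  reflect (tens_rel x y) (\pi_tensor x == \pi_tensor y).
Proof. by rewrite piE /=; exact: asboolP. Qed.

Lemma tensor_reprP (x : seq (M * N)) : tens_rel (repr (\pi_tensor x)) x.
Proof. by apply/tensor_piP; rewrite reprK. Qed.

Definition tens0 : tensor := \pi_tensor [::].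
Definition tens_add (x y : tensor) : tensor := \pi_tensor (repr x ++ repr y).
Definition tens_opp (x : tensor) : tensor :=
  \pi_tensor [seq (- p.1, p.2) | p <- repr x].

Lemma tens_add_pi (x y : seq (M * N)) :
  tens_add (\pi_tensor x) (\pi_tensor y) = \pi_tensor (x ++ y).
Proof. by apply/eqP/tensor_piP; apply: tens_cat; exact: tensor_reprP. Qed.

Fact tens_addA : associative tens_add.
Proof.
elim/quotW=> x; elim/quotW=> y; elim/quotW=> z.
rewrite (tens_add_pi y z) (tens_add_pi x (y ++ z)) (tens_add_pi x y).
by rewrite tens_add_pi catA.
Qed.

Fact tens_addC : commutative tens_add.
Proof. by move=> x y; apply/eqP/tensor_piP; exact: tens_catC. Qed.

Fact tens_add0 : left_id tens0 tens_add.
Proof. by move=> x; rewrite -[x]reprK /tens0 tens_add_pi. Qed.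

Lemma tens_rel_opp (s : seq (M * N)) :
  tens_rel ([seq (- p.1, p.2) | p <- s] ++ s) [::].
Proof.
elim: s => [|[m n] s IHs] /=; first exact: tens_refl.
rewrite -cat1s -(cat1s (m, n)) catA.
apply: (@tens_trans ([:: (m, n)] ++
   ([:: (- m, n)] ++ [seq (- p.1, p.2) | p <- s]) ++ s)).
  rewrite catA [X in tens_rel _ X]catA.
  by apply: tens_cat; [exact: tens_catC|exact: tens_refl].
rewrite -catA -[X in tens_rel _ X]/([::] ++ [::]).
apply: (@tens_cat [:: (m, n); (- m, n)] [::]) => //.
apply: (@tens_trans [:: (m - m, n)]).
  exact/tens_sym/tens_addl.
by rewrite subrr; exact: tens_zero.
Qed.

Fact tens_addN : left_inverse tens0 tens_opp tens_add.
Proof.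
move=> x; rewrite -[X in tens_add _ X]reprK tens_add_pi.
by apply/eqP/tensor_piP; exact: tens_rel_opp.
Qed.

HB.instance Definition _ :=
  GRing.isZmodule.Build tensor tens_addA tens_addC tens_add0 tens_addN.

Definition pure (m : M) (n : N) : tensor := \pi_tensor [:: (m, n)].

Lemma pureDl (m m' : M) n : pure (m + m') n = pure m n + pure m' n.
Proof.
by rewrite [RHS]tens_add_pi; apply/eqP/tensor_piP; exact: tens_addl.
Qed.

Lemma pureDr m (n n' : N) : pure m (n + n') = pure m n + pure m n'.
Proof.
by rewrite [RHS]tens_add_pi; apply/eqP/tensor_piP; exact: tens_addr.
Qed.

Lemma pureZ r m n : pure (r *: m) n = pure m (r *: n).
Proof. by apply/eqP/tensor_piP; exact: tens_bal. Qed.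

Lemma tensor_pi_sum (s : seq (M * N)) :
  \pi_tensor s = \sum_(p <- s) pure p.1 p.2.
Proof.
elim: s => [|[m n] s IHs]; first by rewrite big_nil.
by rewrite big_cons -IHs [RHS]tens_add_pi.
Qed.

Lemma tensor_ind (P : tensor -> Prop) :
  P 0 -> (forall m n, P (pure m n)) -> (forall x y, P x -> P y -> P (x + y)) ->
  forall x, P x.
Proof.
move=> P0 Pp PD x; rewrite -[x]reprK tensor_pi_sum.
by apply: (big_ind P) => // p _; exact: Pp.
Qed.

Definition balanced (A : zmodType) (f : M -> N -> A) : Prop :=
  [/\ forall m m' n, f (m + m') n = f m n + f m' n,
      forall m n n', f m (n + n') = f m n + f m n' &
      forall (r : R) m n, f (r *: m) n = f m (r *: n)].

(* The additive map m (x) n |-> f m n; meaningful when f is balanced.         *)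
Definition tens_lift (A : zmodType) (f : M -> N -> A) (x : tensor) : A :=
  \sum_(p <- repr x) f p.1 p.2.

Section Lift.
Variables (A : zmodType) (f : M -> N -> A).
Hypothesis fB : balanced f.

Lemma tens_lift_pi (s : seq (M * N)) :
  tens_lift f (\pi_tensor s) = \sum_(p <- s) f p.1 p.2.
Proof.
have [fDl fDr fZ] := fB.
suff sumE x y : tens_rel x y ->
  \sum_(p <- x) f p.1 p.2 = \sum_(p <- y) f p.1 p.2.
  exact/sumE/tensor_reprP.
elim=> {x y} //=.
- by move=> y x z _ -> _ ->.
- by move=> x x' y y' _ xx' _ yy'; rewrite !big_cat xx' yy'.
- by move=> x y; rewrite !big_cat /= addrC.
- move=> n; rewrite big_seq1 big_nil /=.
  by apply: (addIr (f 0 n)); rewrite -fDl !add0r.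
- by move=> m m' n; rewrite !big_cons !big_nil /= !addr0 fDl.
- by move=> m n n'; rewrite !big_cons !big_nil /= !addr0 fDr.
- by move=> r m n; rewrite !big_seq1 /= fZ.
Qed.

Lemma tens_lift_pure m n : tens_lift f (pure m n) = f m n.
Proof. by rewrite tens_lift_pi big_seq1. Qed.

Lemma tens_liftD : {morph tens_lift f : x y / x + y}.
Proof.
move=> x y; rewrite -[x]reprK -[y]reprK [_ + _]tens_add_pi.
by rewrite !tens_lift_pi big_cat.
Qed.

Lemma tens_lift0 : tens_lift f 0 = 0.
Proof. by apply: etrans (tens_lift_pi [::]) _; rewrite big_nil. Qed.

End Lift.

End TensorProduct.

(* S viewed as an R-module through f : R -> S.                                *)
Definition ralg (R S : comPzRingType) (f : {rmorphism R -> S}) : Type := S.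

Section RestrictedScalars.
Variables (R S : comPzRingType) (f : {rmorphism R -> S}).

HB.instance Definition _ := GRing.Zmodule.copy (ralg f) S.

Definition ralg_scale (r : R) (s : ralg f) : ralg f := f r * (s : S).

Fact ralg_scaleA a b v : ralg_scale a (ralg_scale b v) = ralg_scale (a * b) v.
Proof. by rewrite /ralg_scale mulrA rmorphM. Qed.

Fact ralg_scale1 : left_id 1 ralg_scale.
Proof. by move=> v; rewrite /ralg_scale rmorph1 mul1r. Qed.

Fact ralg_scaleDr : right_distributive ralg_scale +%R.
Proof. by move=> a u v; rewrite /ralg_scale mulrDr. Qed.

Fact ralg_scaleDl v : {morph ralg_scale^~ v : a b / a + b}.
Proof. by move=> a b; rewrite /ralg_scale rmorphD mulrDl. Qed.

HB.instance Definition _ := GRing.Zmodule_isLmodule.Build R (ralg f)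
  ralg_scaleA ralg_scale1 ralg_scaleDr ralg_scaleDl.

Lemma ralg_scaleE (r : R) (s : ralg f) : r *: s = f r * (s : S).
Proof. by []. Qed.

End RestrictedScalars.

(* The S-module S (x)_R U, for S an R-algebra through f.                      *)
Definition basechange (R S : comPzRingType) (f : {rmorphism R -> S})
  (U : lmodType R) : Type := tensor (ralg f) U.

Definition bc_pure (R S : comPzRingType) (f : {rmorphism R -> S})
  (U : lmodType R) (s : S) (u : U) : basechange f U :=
  pure (s : ralg f) u.

Section BaseChange.
Variables (R S : comPzRingType) (f : {rmorphism R -> S}) (U : lmodType R).
Local Notation T := (basechange f U).

HB.instance Definition _ := GRing.Zmodule.on T.

Lemma bc_pureDl s s' u :
  bc_pure f (s + s') u = bc_pure f s u + bc_pure f s' u :> T.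
Proof. exact: pureDl. Qed.

Lemma bc_pureDr s u u' :
  bc_pure f s (u + u') = bc_pure f s u + bc_pure f s u' :> T.
Proof. exact: pureDr. Qed.

Lemma bc_pureZ s r u : bc_pure f (f r * s) u = bc_pure f s (r *: u) :> T.
Proof. exact: pureZ. Qed.

Definition bc_scale (s : S) (x : T) : T :=
  tens_lift
    (fun (t : ralg f) (u : U) => bc_pure f (s * (t : S)) u : T) x.

Lemma bc_scale_balanced s :
  balanced (fun (t : ralg f) (u : U) => bc_pure f (s * (t : S)) u : T).
Proof.
split=> [m m' n|m n n'|r m n].
- by rewrite mulrDr bc_pureDl.
- by rewrite bc_pureDr.
- by rewrite ralg_scaleE mulrCA bc_pureZ.
Qed.

Lemma bc_scale_pure s t u : bc_scale s (bc_pure f t u) = bc_pure f (s * t) u.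
Proof. exact: (tens_lift_pure (bc_scale_balanced s)). Qed.

Fact bc_scaleDr : right_distributive bc_scale +%R.
Proof. by move=> s x y; exact: (tens_liftD (bc_scale_balanced s)). Qed.

Lemma bc_scale0 s : bc_scale s 0 = 0.
Proof. exact: (tens_lift0 (bc_scale_balanced s)). Qed.

Fact bc_scaleA a b v : bc_scale a (bc_scale b v) = bc_scale (a * b) v.
Proof.
elim/tensor_ind: v => [|t u|x y IHx IHy].
- by rewrite !bc_scale0.
- by rewrite !bc_scale_pure mulrA.
- by rewrite !bc_scaleDr IHx IHy.
Qed.

Fact bc_scale1 : left_id 1 bc_scale.
Proof.
elim/tensor_ind => [|t u|x y IHx IHy].
- exact: bc_scale0.
- by rewrite bc_scale_pure mul1r.
- by rewrite bc_scaleDr IHx IHy.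
Qed.

Fact bc_scaleDl v : {morph bc_scale^~ v : a b / a + b}.
Proof.
move=> a b; elim/tensor_ind: v => [|t u|x y IHx IHy].
- by rewrite !bc_scale0 addr0.
- by rewrite !bc_scale_pure mulrDl bc_pureDl.
- by rewrite !bc_scaleDr IHx IHy addrACA.
Qed.

HB.instance Definition _ := GRing.Zmodule_isLmodule.Build S T
  bc_scaleA bc_scale1 bc_scaleDr bc_scaleDl.

Lemma bc_scaleE s t u :
  s *: (bc_pure f t u : T) = bc_pure f (s * t) u.
Proof. exact: bc_scale_pure. Qed.

End BaseChange.

(* The ring S (x)_R T, for S and T two R-algebras through f and g.            *)
Definition tring (R S T : comPzRingType)
  (f : {rmorphism R -> S}) (g : {rmorphism R -> T}) : Type :=
  tensor (ralg f) (ralg g).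

Definition tr_pure (R S T : comPzRingType)
  (f : {rmorphism R -> S}) (g : {rmorphism R -> T}) (s : S) (t : T) :
  tring f g := pure (s : ralg f) (t : ralg g).

Section TensorRing.
Variables (R S T : comPzRingType).
Variables (f : {rmorphism R -> S}) (g : {rmorphism R -> T}).
Local Notation A := (tring f g).

HB.instance Definition _ := GRing.Zmodule.on A.

Lemma tr_pureDl s s' t :
  tr_pure f g (s + s') t = tr_pure f g s t + tr_pure f g s' t.
Proof. exact: pureDl. Qed.

Lemma tr_pureDr s t t' :
  tr_pure f g s (t + t') = tr_pure f g s t + tr_pure f g s t'.
Proof. exact: pureDr. Qed.

Lemma tr_pureZ s t r : tr_pure f g (f r * s) t = tr_pure f g s (g r * t).
Proof. exact: pureZ. Qed.

Definition tr_mul1 (s : S) (t : T) (y : A) : A :=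
  tens_lift (fun (s' : ralg f) (t' : ralg g) =>
    tr_pure f g (s * (s' : S)) (t * (t' : T))) y.

Definition tr_mul (x y : A) : A := 
  tens_lift (fun (s : ralg f) (t : ralg g) => tr_mul1 s t y) x.

Lemma tr_mul1_balanced s t : balanced (fun (s' : ralg f) (t' : ralg g) =>
  tr_pure f g (s * (s' : S)) (t * (t' : T))).
Proof.
split=> [m m' n|m n n'|r m n].
- by rewrite mulrDr tr_pureDl.
- by rewrite mulrDr tr_pureDr.
- by rewrite !ralg_scaleE mulrCA tr_pureZ mulrCA.
Qed.

Lemma tr_mul1_pure s t s' t' :
  tr_mul1 s t (tr_pure f g s' t') = tr_pure f g (s * s') (t * t').
Proof. exact: (tens_lift_pure (tr_mul1_balanced s t)). Qed.

Lemma tr_mul1D s t : {morph tr_mul1 s t : x y / x + y}.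
Proof. exact: (tens_liftD (tr_mul1_balanced s t)). Qed.

Lemma tr_mul10 s t : tr_mul1 s t 0 = 0.
Proof. exact: (tens_lift0 (tr_mul1_balanced s t)). Qed.

Lemma tr_mul_balanced y :
  balanced (fun (s : ralg f) (t : ralg g) => tr_mul1 s t y).
Proof.
split=> [m m' n|m n n'|r m n]; elim/tensor_ind: y => [|s t|x y IHx IHy].
- by rewrite !tr_mul10 addr0.
- by rewrite !tr_mul1_pure mulrDl tr_pureDl.
- by rewrite !tr_mul1D IHx IHy addrACA.
- by rewrite !tr_mul10 addr0.
- by rewrite !tr_mul1_pure mulrDl tr_pureDr.
- by rewrite !tr_mul1D IHx IHy addrACA.
- by rewrite !tr_mul10.
- by rewrite !tr_mul1_pure !ralg_scaleE -!mulrA tr_pureZ.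
- by rewrite !tr_mul1D IHx IHy.
Qed.

Lemma tr_mul_pure s t s' t' :
  tr_mul (tr_pure f g s t) (tr_pure f g s' t') = tr_pure f g (s * s') (t * t').
Proof.
rewrite -tr_mul1_pure.
exact: (tens_lift_pure (tr_mul_balanced (tr_pure f g s' t'))).
Qed.

Fact tr_mulDl : left_distributive tr_mul +%R.
Proof. by move=> x y z; exact: (tens_liftD (tr_mul_balanced z)). Qed.

Lemma tr_mul0l y : tr_mul 0 y = 0.
Proof. exact: (tens_lift0 (tr_mul_balanced y)). Qed.

Lemma tr_mulDr : right_distributive tr_mul +%R.
Proof.
move=> x y z; elim/tensor_ind: x => [|s t|x x' IHx IHx'].
- by rewrite !tr_mul0l addr0.
- have E w : tr_mul (pure s t) w = tr_mul1 s t w.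
    exact: (tens_lift_pure (tr_mul_balanced w)).
  by rewrite !E tr_mul1D.
- by rewrite !tr_mulDl IHx IHx' addrACA.
Qed.

Fact tr_mulC : commutative tr_mul.
Proof.
have mul0r y : tr_mul y 0 = 0.
  by apply: (addIr (tr_mul y 0)); rewrite -tr_mulDr !add0r.
move=> x y; elim/tensor_ind: x => [|s t|x x' IHx IHx'].
- by rewrite tr_mul0l mul0r.
- elim/tensor_ind: y => [|s' t'|y y' IHy IHy'].
  + by rewrite tr_mul0l mul0r.
  + by rewrite !tr_mul_pure mulrC [X in tr_pure _ _ _ X]mulrC.
  + by rewrite tr_mulDl tr_mulDr IHy IHy'.
- by rewrite tr_mulDl tr_mulDr IHx IHx'.
Qed.

Fact tr_mulA : associative tr_mul.
Proof.
have mul0r y : tr_mul y 0 = 0 by rewrite tr_mulC tr_mul0l.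
move=> x y z; elim/tensor_ind: x => [|s t|x x' IHx IHx'].
- by rewrite !tr_mul0l.
- elim/tensor_ind: y => [|s' t'|y y' IHy IHy'].
  + by rewrite mul0r !tr_mul0l mul0r.
  + elim/tensor_ind: z => [|s2 t2|z z' IHz IHz'].
    * by rewrite !mul0r.
    * by rewrite !tr_mul_pure !mulrA.
    * by rewrite !tr_mulDr IHz IHz'.
  + by rewrite !(tr_mulDl, tr_mulDr) IHy IHy'.
- by rewrite !tr_mulDl IHx IHx'.
Qed.

Fact tr_mul1l : left_id (tr_pure f g 1 1) tr_mul.
Proof.
have mul0r y : tr_mul y 0 = 0 by rewrite tr_mulC tr_mul0l.
elim/tensor_ind => [|s t|x y IHx IHy].
- exact: mul0r.
- by rewrite tr_mul_pure !mul1r.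
- by rewrite tr_mulDr IHx IHy.
Qed.

HB.instance Definition _ := GRing.Zmodule_isComPzRing.Build A
  tr_mulA tr_mulC tr_mul1l tr_mulDl.

Lemma tr_pureM s t s' t' :
  tr_pure f g s t * tr_pure f g s' t' = tr_pure f g (s * s') (t * t').
Proof. exact: tr_mul_pure. Qed.

Lemma tr_pure0l t : tr_pure f g 0 t = 0.
Proof. by apply: (addIr (tr_pure f g 0 t)); rewrite -tr_pureDl !add0r. Qed.

Lemma tr_pure0r s : tr_pure f g s 0 = 0.
Proof. by apply: (addIr (tr_pure f g s 0)); rewrite -tr_pureDr !add0r. Qed.

Definition tr_inl (s : S) : A := tr_pure f g s 1.
Definition tr_inr (t : T) : A := tr_pure f g 1 t.

Fact tr_inl_zmod : zmod_morphism tr_inl.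
Proof.
move=> s s'; apply: (addIr (tr_inl s')).
by rewrite subrK -tr_pureDl subrK.
Qed.

Fact tr_inl_monoid : monoid_morphism tr_inl.
Proof. by split=> // s s'; rewrite /tr_inl tr_pureM mulr1. Qed.

HB.instance Definition _ := GRing.isZmodMorphism.Build S A tr_inl tr_inl_zmod.
HB.instance Definition _ := GRing.isMonoidMorphism.Build S A tr_inl
  tr_inl_monoid.

Fact tr_inr_zmod : zmod_morphism tr_inr.
Proof.
move=> s s'; apply: (addIr (tr_inr s')).
by rewrite subrK -tr_pureDr subrK.
Qed.

Fact tr_inr_monoid : monoid_morphism tr_inr.
Proof. by split=> // s s'; rewrite /tr_inr tr_pureM mulr1. Qed.

HB.instance Definition _ := GRing.isZmodMorphism.Build T A tr_inr tr_inr_zmod.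
HB.instance Definition _ := GRing.isMonoidMorphism.Build T A tr_inr
  tr_inr_monoid.

(* The structure morphism R -> S (x)_R T.                                     *)
Definition tr_base : {rmorphism R -> A} := tr_inl \o f.

Lemma tr_inl_base r : tr_inl (f r) = tr_base r.
Proof. by []. Qed.

Lemma tr_inr_base r : tr_inr (g r) = tr_base r.
Proof.
by rewrite /tr_inr /= /tr_inl -[f r]mulr1 tr_pureZ mulr1.
Qed.

End TensorRing.

Section Swap.
Variables (R S T : comPzRingType).
Variables (f : {rmorphism R -> S}) (g : {rmorphism R -> T}).

Definition tr_swap : tring f g -> tring g f :=
  tens_lift (fun (s : ralg f) (t : ralg g) => tr_pure g f t s).

Lemma tr_swap_balanced :
  balanced (fun (s : ralg f) (t : ralg g) => tr_pure g f t s).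
Proof.
split=> [m m' n|m n n'|r m n].
- by rewrite tr_pureDr.
- by rewrite tr_pureDl.
- by rewrite !ralg_scaleE -tr_pureZ.
Qed.

Lemma tr_swap_pure s t : tr_swap (tr_pure f g s t) = tr_pure g f t s.
Proof. exact: (tens_lift_pure tr_swap_balanced). Qed.

Lemma tr_swapD : {morph tr_swap : x y / x + y}.
Proof. exact: (tens_liftD tr_swap_balanced). Qed.

Fact tr_swap_zmod : zmod_morphism tr_swap.
Proof.
by move=> x y; apply: (addIr (tr_swap y)); rewrite subrK -tr_swapD subrK.
Qed.

Fact tr_swap_monoid : monoid_morphism tr_swap.
Proof.
have swap0 : tr_swap 0 = 0 := tens_lift0 tr_swap_balanced.
split; first exact: tr_swap_pure.
move=> x y; elim/tensor_ind: x => [|s t|x x' IHx IHx'].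
- by rewrite !(mul0r, swap0).
- elim/tensor_ind: y => [|s' t'|y y' IHy IHy'].
  + by rewrite !(mulr0, swap0).
  + by rewrite tr_pureM !tr_swap_pure tr_pureM.
  + by rewrite mulrDr !tr_swapD mulrDr IHy IHy'.
- by rewrite mulrDl !tr_swapD mulrDl IHx IHx'.
Qed.

HB.instance Definition _ :=
  GRing.isZmodMorphism.Build (tring f g) (tring g f) tr_swap tr_swap_zmod.
HB.instance Definition _ :=
  GRing.isMonoidMorphism.Build (tring f g) (tring g f) tr_swap tr_swap_monoid.

Lemma tr_swap_base r : tr_swap (tr_base f g r) = tr_base g f r.
Proof. by rewrite -tr_inr_base /= tr_swap_pure. Qed.

End Swap.

Section BaseChangeMaps.
Variables (R S T : comPzRingType).
Variables (f : {rmorphism R -> S}) (g : {rmorphism S -> T}).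
Variables (h : {rmorphism R -> T}) (gf : forall r, g (f r) = h r).
Variable U : lmodType R.

(* S (x)_R U -> T (x)_R U, s (x) u |-> g s (x) u.                             *)
Definition bc_map of (forall r, g (f r) = h r) :
    basechange f U -> basechange h U :=
  tens_lift (fun (s : ralg f) (u : U) => bc_pure h (g s) u).

Lemma bc_map_balanced :
  balanced (fun (s : ralg f) (u : U) => bc_pure h (g s) u : basechange h U).
Proof.
split=> [m m' n|m n n'|r m n].
- by rewrite [g _]rmorphD bc_pureDl.
- by rewrite bc_pureDr.
- by rewrite ralg_scaleE rmorphM gf bc_pureZ.
Qed.

Lemma bc_map_pure s u : bc_map gf (bc_pure f s u) = bc_pure h (g s) u.
Proof. exact: (tens_lift_pure bc_map_balanced). Qed.

Lemma bc_mapD : {morph bc_map gf : x y / x + y}.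
Proof. exact: (tens_liftD bc_map_balanced). Qed.

Lemma bc_map0 : bc_map gf 0 = 0.
Proof. exact: (tens_lift0 bc_map_balanced). Qed.

Lemma bc_mapZ s x : bc_map gf (s *: x) = g s *: bc_map gf x.
Proof.
elim/tensor_ind: x => [|t u|x y IHx IHy].
- by rewrite scaler0 bc_map0 scaler0.
- by rewrite bc_scaleE !bc_map_pure bc_scaleE rmorphM.
- by rewrite scalerDr !bc_mapD scalerDr IHx IHy.
Qed.

(* The identification T (x)_S (S (x)_R U) = T (x)_R U,                        *)
(* t (x) (s (x) u) |-> t g(s) (x) u.                                          *)
Definition bc_assoc (gf' : forall r, g (f r) = h r) :
    basechange g (basechange f U) -> basechange h U :=
  tens_lift (fun (t : ralg g) (x : basechange f U) => (t : T) *: bc_map gf' x).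

Lemma bc_assoc_balanced :
  balanced (fun (t : ralg g) (x : basechange f U) => (t : T) *: bc_map gf x).
Proof.
split=> [m m' n|m n n'|r m n].
- by rewrite scalerDl.
- by rewrite bc_mapD scalerDr.
- by rewrite ralg_scaleE bc_mapZ scalerA mulrC.
Qed.

Lemma bc_assoc_pure t s u :
  bc_assoc gf (bc_pure g t (bc_pure f s u)) = bc_pure h (t * g s) u.
Proof.
rewrite -bc_scaleE -bc_map_pure.
exact: (tens_lift_pure bc_assoc_balanced).
Qed.

Lemma bc_assocD : {morph bc_assoc gf : x y / x + y}.
Proof. exact: (tens_liftD bc_assoc_balanced). Qed.

Lemma bc_assoc_bij : bijective (bc_assoc gf).
Proof.
have invB : balanced (fun (t : ralg h) (u : U) =>
    bc_pure g t (bc_pure f 1 u) : basechange g (basechange f U)).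
  split=> [m m' n|m n n'|r m n].
  - by rewrite bc_pureDl.
  - by rewrite !bc_pureDr.
  - by rewrite ralg_scaleE -gf bc_pureZ bc_scaleE mulr1 -bc_pureZ mulr1.
pose inv := tens_lift (fun (t : ralg h) (u : U) =>
    bc_pure g t (bc_pure f 1 u) : basechange g (basechange f U)).
have inv_pure t u : inv (bc_pure h t u) = bc_pure g t (bc_pure f 1 u).
  exact: (tens_lift_pure invB).
have invD : {morph inv : x y / x + y} by exact: (tens_liftD invB).
have inv0 : inv 0 = 0 := tens_lift0 invB.
have assoc0 : bc_assoc gf 0 = 0 := tens_lift0 bc_assoc_balanced.
have pure0 t : bc_pure g t 0 = 0 :> basechange g (basechange f U).
  by apply: (addIr (bc_pure g t 0)); rewrite -bc_pureDr !add0r.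
exists inv => [x|x].
- elim/tensor_ind: x => [|t y|x y IHx IHy].
  + by rewrite assoc0 inv0.
  + elim/tensor_ind: y => [|s u|y y' IHy IHy'].
    * by rewrite [pure _ _]pure0 assoc0 inv0.
    * by rewrite bc_assoc_pure inv_pure mulrC bc_pureZ bc_scaleE mulr1.
    * by rewrite [pure _ _]bc_pureDr bc_assocD invD IHy IHy'.
  + by rewrite bc_assocD invD IHx IHy.
- elim/tensor_ind: x => [|t u|x y IHx IHy].
  + by rewrite inv0 assoc0.
  + by rewrite inv_pure bc_assoc_pure rmorph1 mulr1.
  + by rewrite invD bc_assocD IHx IHy.
Qed.

End BaseChangeMaps.

(* An ordinal is given as an element [ord_elt] of a well-ordered set: it      *)
(* stands for the order type of the initial segment strictly below it, the    *)
(* smaller ordinals being the elements of that segment.                       *)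
Record wordinal := WOrdinal {
  ord_disp : Order.disp_t;
  ord_type : orderType ord_disp;
  ord_wf : well_founded (fun x y : ord_type => (x < y)%O);
  ord_elt : ord_type }.

Section QuiteDifferentialOperators.
Variables (K R : comPzRingType) (kappa : {rmorphism K -> R}).
Variables (U V : lmodType R).

Definition Klinear (e : U -> V) : Prop :=
  forall (k : K) (u u' : U),
    e (kappa k *: u + u') = kappa k *: e u + e u'.

Definition bimod_comm (r : R) (e : U -> V) : U -> V :=
  fun u => r *: e u - e (r *: u).

(* quite_filt a e: the map e belongs to F_a; the recursion on a is            *)
(* well-founded when O is.                                                    *)
Inductive quite_filt (d : Order.disp_t) (O : orderType d) :
    O -> (U -> V) -> Prop :=
| quite_filt_zero (a : O) (e : U -> V) of
    (forall b : O, ~~ (b < a)%O) &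
    (forall (r : R) (u : U), bimod_comm r e u = 0) : quite_filt a e
| quite_filt_pos (a : O) (e : U -> V) of
    (exists b : O, (b < a)%O) &
    (forall r : R, exists2 b : O, (b < a)%O & quite_filt b (bimod_comm r e)) :
    quite_filt a e.

Definition quite_diffop_le (alpha : wordinal) (e : U -> V) : Prop :=
  Klinear e /\ quite_filt (ord_elt alpha) e.

Definition quite_diffop (e : U -> V) : Prop :=
  exists alpha : wordinal, quite_diffop_le alpha e.

End QuiteDifferentialOperators.

(* D' : A' (x)_A M -> A' (x)_A N is induced by D : M -> N.                    *)
Definition induced (K A A' : comPzRingType) (kappa : {rmorphism K -> A})
    (f : {rmorphism A -> A'}) (M N : lmodType A)
    (D : M -> N) (D' : basechange f M -> basechange f N) : Prop :=
  [/\ quite_diffop kappa D,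
      quite_diffop (f \o kappa) D' &
      forall m, D' (bc_pure f 1 m) = bc_pure f 1 (D m)].

(* The same for R -> S -> T and an operator D : S (x)_R U -> S (x)_R V, with  *)
(* T (x)_S (S (x)_R -) identified with T (x)_R -.                             *)
Definition induced_tower (K R S T : comPzRingType) (kappa : {rmorphism K -> R})
    (f : {rmorphism R -> S}) (g : {rmorphism S -> T}) (h : {rmorphism R -> T})
    (gf : forall r, g (f r) = h r) (U V : lmodType R)
    (D : basechange f U -> basechange f V)
    (D' : basechange h U -> basechange h V) : Prop :=
  exists2 D'' : basechange g (basechange f U) -> basechange g (basechange f V),
    induced (f \o kappa) D D'' &
    forall x, D' (bc_assoc gf x) = bc_assoc gf (D'' x).

Local Open Scope classical_set_scope.

Record Spec (R : comPzRingType) := MkSpec {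
  prime_set :> set R;
  prime0 : prime_set 0;
  primeD : forall x y, prime_set x -> prime_set y -> prime_set (x + y);
  primeMl : forall x y, prime_set y -> prime_set (x * y);
  prime_proper : ~ prime_set 1;
  prime_mul : forall x y, prime_set (x * y) -> prime_set x \/ prime_set y }.

HB.instance Definition _ (R : comPzRingType) := gen_eqMixin (Spec R).
HB.instance Definition _ (R : comPzRingType) := gen_choiceMixin (Spec R).

Section Zariski.
Variable R : comPzRingType.

(* complements of the closed sets V(E)                                        *)
Definition zariski_open (W : set (Spec R)) : Prop :=
  exists E : set R, W = [set p | exists2 x, E x & ~ (p : set R) x].

Fact zariski_openT : zariski_open setT.
Proof.
exists setT; apply/seteqP; split=> // p _.
by exists 1 => //; exact: prime_proper.
Qed.

Fact zariski_openI : setI_closed zariski_open.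
Proof.
move=> _ _ [E ->] [F ->].
exists [set z | exists x y, [/\ E x, F y & z = x * y]].
apply/seteqP; split=> p /=.
  move=> [[x Ex px] [y Fy py]]; exists (x * y); first by exists x, y.
  by move=> /prime_mul [].
move=> [_ [x [y [Ex Fy ->]]] pxy]; split.
  by exists x => // px; apply: pxy; rewrite mulrC; exact: primeMl.
by exists y => // py; apply: pxy; exact: primeMl.
Qed.

Fact zariski_open_bigU (I : Type) (F : I -> set (Spec R)) :
  (forall i, zariski_open (F i)) -> zariski_open (\bigcup_i F i).
Proof.
move=> Fo; exists [set x | exists i (E : set R),
    F i = [set p | exists2 x, E x & ~ (p : set R) x] /\ E x].
apply/seteqP; split=> p /=.
  move=> [i _ Fip]; have [E FE] := Fo i.
  by move: (Fip); rewrite FE => -[x Ex px]; exists x => //; exists i, E.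
move=> [x [i [E [FE Ex]]] px]; exists i => //.
by rewrite FE; exists x.
Qed.

HB.instance Definition _ := isOpenTopological.Build (Spec R)
  zariski_openT zariski_openI zariski_open_bigU.

End Zariski.

Section SpecMap.
Variables (R S : comPzRingType) (f : {rmorphism R -> S}) (q : Spec S).
Let P : set R := f @^-1` q.

Let P0 : P 0.
Proof. by rewrite /P /preimage /= rmorph0; exact: prime0. Qed.

Let PD x y : P x -> P y -> P (x + y).
Proof. by rewrite /P /preimage /= rmorphD; exact: primeD. Qed.

Let PMl x y : P y -> P (x * y).
Proof. by rewrite /P /preimage /= rmorphM; exact: primeMl. Qed.

Let P1 : ~ P 1.
Proof. by rewrite /P /preimage /= rmorph1; exact: prime_proper. Qed.

Let PM x y : P (x * y) -> P x \/ P y.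
Proof. by rewrite /P /preimage /= rmorphM; exact: prime_mul. Qed.

Definition spec_map : Spec R := MkSpec P0 PD PMl P1 PM.

End SpecMap.

Section Localization.
Variables (R : comPzRingType) (p : Spec R).

Definition denom : Type := {s : R | s \notin (p : set R)}.
HB.instance Definition _ := SubChoice.on denom.

Fact denom1_subproof : (1 : R) \notin (p : set R).
Proof. by rewrite notin_setE; exact: prime_proper. Qed.

Lemma denomP (s : denom) : ~ (p : set R) (val s).
Proof. by have := valP s; rewrite notin_setE. Qed.

Fact denomM_subproof (s t : denom) : val s * val t \notin (p : set R).
Proof. by rewrite notin_setE => /prime_mul []; exact: denomP. Qed.

Definition denom1 : denom := Sub 1 denom1_subproof.
Definition denomM (s t : denom) : denom :=
  Sub (val s * val t) (denomM_subproof s t).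

Definition loc_rel (x y : R * denom) : bool :=
  `[< exists u : denom,
        val u * (x.1 * val y.2) = val u * (y.1 * val x.2) >].

Fact loc_rel_refl : reflexive loc_rel.
Proof. by move=> x; apply/asboolP; exists denom1. Qed.

Fact loc_rel_sym : symmetric loc_rel.
Proof. by move=> x y; apply/asboolP/asboolP => -[u xy]; exists u. Qed.

Fact loc_rel_trans : transitive loc_rel.
Proof.
move=> [b t] [a s] [c w] /asboolP[u /= E1] /asboolP[v /= E2]; apply/asboolP.
exists (denomM (denomM u v) t) => /=.
have -> : val u * val v * val t * (a * val w) =
          (val u * (a * val t)) * (val v * val w).
  by rewrite [LHS](AC (3*2) ((1*(4*3))*(2*5))).
rewrite E1.
have -> : val u * (b * val s) * (val v * val w) =
          (val v * (b * val w)) * (val u * val s).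
  by rewrite [LHS](AC ((1*2)*2) ((4*(2*5))*(1*3))).
rewrite E2.
by rewrite [LHS](AC ((1*2)*2) (((4*1)*3)*(2*5))).
Qed.

Canonical loc_equiv := EquivRel loc_rel loc_rel_refl loc_rel_sym loc_rel_trans.

(* The localization R_p.                                                      *)
Definition loc : Type := {eq_quot loc_equiv}.

HB.instance Definition _ := Choice.on loc.
HB.instance Definition _ := EqQuotient.on loc.

Definition loc_frac (a : R) (s : denom) : loc := \pi_loc (a, s).

Lemma loc_fracP a s b t :
  loc_frac a s = loc_frac b t <->
  exists u : denom, val u * (a * val t) = val u * (b * val s).
Proof.
rewrite /loc_frac; split=> [/eqP|abst].
  by rewrite piE /= => /asboolP.
by apply/eqP; rewrite piE /=; apply/asboolP.
Qed.

End Localization.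

Arguments denomP {R p} s.

Section LocalMap.
Variables (R S : comPzRingType) (f : {rmorphism R -> S}) (q : Spec S).

Fact denom_map_subproof (s : denom (spec_map f q)) :
  f (val s) \notin (q : set S).
Proof. by rewrite notin_setE; exact: (denomP s). Qed.

Definition denom_map (s : denom (spec_map f q)) : denom q :=
  Sub (f (val s)) (denom_map_subproof s).

(* The map R_(f^-1 q) -> S_q, a / s |-> f a / f s.                            *)
Definition loc_map (x : loc (spec_map f q)) : loc q :=
  loc_frac (f (repr x).1) (denom_map (repr x).2).

Lemma loc_map_frac a s : loc_map (loc_frac a s) = loc_frac (f a) (denom_map s).
Proof.
rewrite /loc_map; case E : (repr (loc_frac a s)) => [b t] /=.
have /loc_fracP[u /= E'] : loc_frac b t = loc_frac a s.
  by rewrite /loc_frac -E reprK.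
apply/loc_fracP; exists (denom_map u) => /=.
by rewrite -!rmorphM E'.
Qed.

End LocalMap.

(* Sections over W of the structure sheaf of Spec R: families of elements of  *)
(* the R_p, p in W, that are locally given by a single fraction.              *)
Definition is_section (R : comPzRingType) (W : set (Spec R))
    (s : forall p, W p -> loc p) : Prop :=
  forall p, W p -> exists W' : set (Spec R),
    [/\ open W', W' p, W' `<=` W &
        exists a b : R, forall q (Wq : W q), W' q ->
          exists bq : b \notin (q : set R), s q Wq = loc_frac a (Sub b bq)].

(* The morphism (Spec f, f^#) is an open immersion: Spec f is a homeomorphism *)
(* onto an open subset V, and f^# : O(W) -> O((Spec f)^-1 W) is bijective for *)
(* every open W contained in V.                                               *)
Definition open_immersion (R S : comPzRingType) (f : {rmorphism R -> S}) :
    Prop :=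
  [/\ injective (spec_map f),
      continuous (spec_map f : Spec S -> Spec R),
      forall W : set (Spec S), open W -> open (spec_map f @` W) &
      forall W : set (Spec R), open W -> W `<=` range (spec_map f) ->
      forall t : forall q, (spec_map f @^-1` W) q -> loc q, is_section t ->
      exists! s : forall p, W p -> loc p,
        is_section s /\
        forall q (Wq : W (spec_map f q)),
          loc_map (s (spec_map f q) Wq) = t q Wq].

Definition affine_open_covering (R : comPzRingType) (n : nat)
    (S : 'I_n -> comPzRingType) (f : forall l, {rmorphism R -> S l}) : Prop :=
  (forall l, open_immersion (f l)) /\
  \bigcup_l range (spec_map (f l)) = setT.

(* Main.v *)
(* Only the values of the operators on pure tensors 1 (x) u matter. For every *)
(* prime p some R -> S_l is an isomorphism after localization at p, so an     *)
(* element of V vanishing in every S_l (x) V has an annihilator contained in  *)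
(* no prime. Given u, the elements v_l = D_l (1 (x) u) agree over the S_jl,   *)
(* and the e in R such that the e v_j all come from a single element of V     *)
(* form an ideal contained in no prime; hence the v_l come from a unique      *)
(* D u. Commutators of D with r induce those of D_l with r, so the order of D *)
(* is bounded by well-founded induction, n being finite.                      *)

Require Import Defs.
From HB Require Import structures.
From mathcomp Require Import all_boot all_order all_algebra.
From mathcomp Require Import ring boolp classical_sets topology.

Set Implicit Arguments.
Unset Strict Implicit.
Unset Printing Implicit Defensive.

Import Order.TTheory GRing.Theory.

Local Open Scope ring_scope.
Local Open Scope classical_set_scope.

(** Modules descend along the covering: compatible elements of the S_l (x) V come from exactly one
    element of V ([section_inj], [section_glue]). For the elements D_l (1 (x) u) this element is D
    u. Linearity of D and vanishing of its iterated commutators can be tested in all the S_l (x) V,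
    which carries the order bound from the D_l to D ([quite_filt_local]). Descent is checked prime
    by prime: an ideal contained in no prime is the unit ideal ([ideal_full]), and at each prime p
    some R -> S_l becomes an isomorphism after localization ([open_immersion_local_iso]). Localized
    modules are never formed; a statement over R_p is expressed through a multiplier outside p. *)

(** * Primes avoiding a multiplicative set *)

Section PrimeAvoidance.
Variable R : comPzRingType.

Definition is_ideal (J : set R) : Prop :=
  [/\ J 0, forall x y, J x -> J y -> J (x + y) &
      forall r x, J x -> J (r * x)].

Lemma prime_avoiding (J T : set R) :
  is_ideal J -> T 1 -> (forall x y, T x -> T y -> T (x * y)) ->
  (forall x, J x -> ~ T x) ->
  exists p : Spec R, J `<=` p /\ forall x, T x -> ~ (p : set R) x.
Proof.
move=> [J0 JD JM] T1 TM JT.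
(* Zorn's lemma also requires a bound for the empty chain, whose union is empty; taking the union
   with [J] makes that case the ideal [J] itself. *)
pose P (A : set R) := is_ideal (J `|` A) /\ forall x, (J `|` A) x -> ~ T x.
have [F FP Ftot|A [[[A0 AD AM] AT] Amax]] := @Zorn_bigcup R P.
  split; first split.
  - by left.
  - have FD X x y : F X -> (J `|` X) x -> (J `|` X) y ->
        (J `|` \bigcup_(X in F) X) (x + y).
      by move=> FX Xx Xy; have [[_ XD _] _] := FP X FX;
        case: (XD _ _ Xx Xy); [left|right; exists X].
    move=> x y [Jx|[X FX Xx]] [Jy|[Y FY Yy]].
    + by left; exact: JD.
    + by apply: (FD Y) => //; [left|right].
    + by apply: (FD X) => //; [right|left].
    + have [XY|YX] := Ftot X Y FX FY.
        by apply: (FD Y) => //; right => //; exact: XY.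
      by apply: (FD X) => //; right => //; exact: YX.
  - move=> r x [Jx|[X FX Xx]]; first by left; exact: JM.
    have [[_ _ XM] _] := FP X FX.
    by case: (XM r x (or_intror Xx)); [left|right; exists X].
  - move=> x [Jx|[X FX Xx]]; first exact: JT.
    by have [_ XT] := FP X FX; apply: XT; right.
set p := J `|` A in A0 AD AM AT.
(* By maximality, the ideal [p] + (x) must meet [T]. *)
have extend x : ~ p x ->
    exists2 t, T t & exists2 a, p a & exists r, t = a + r * x.
  move=> px; apply: contrapT => noT.
  pose B := [set z | exists2 a, p a & exists r, z = a + r * x].
  have pB : p `<=` B by move=> z pz; exists z => //; exists 0; ring.
  have Bx : B x by exists 0 => //; exists 1; ring.
  have JB : J `|` B = B by apply/setUidPr => z Jz; apply: pB; left.
  apply: (Amax B).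
    split; first by move=> z Az; apply: pB; right.
    by move=> BA; apply: px; right; exact: BA.
  split; rewrite JB; first split.
  - exact: pB.
  - move=> _ _ [a pa [r ->]] [b pb [s ->]].
    by exists (a + b); [exact: AD|exists (r + s); ring].
  - move=> s _ [a pa [r ->]].
    by exists (s * a); [exact: AM|exists (s * r); ring].
  - move=> z [a pa [r zE]] Tz; apply: noT; exists z => //.
    by exists a => //; exists r.
have p1 : ~ p 1 by move=> /AT.
have pM x y : p (x * y) -> p x \/ p y.
  move=> pxy; apply: contrapT => /not_orP[px py].
  have [t Tt [a pa [r tE]]] := extend x px.
  have [s Ts [b pb [q sE]]] := extend y py.
  apply: (AT (t * s)); last exact: TM.
  have -> : t * s = s * a + (r * x * b + r * q * (x * y)) by rewrite tE sE; ring.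
  by apply: (AD); [exact: AM|apply: AD; exact: AM].
exists (MkSpec A0 AD AM p1 pM); split=> [x Jx|x Tx px]; first by left.
exact: AT px Tx.
Qed.

Lemma ideal_full (J : set R) :
  is_ideal J -> (forall p : Spec R, exists2 c, J c & ~ (p : set R) c) -> J 1.
Proof.
move=> idJ Jp; apply: contrapT => J1.
have [|||p [Jlep _]] := prime_avoiding idJ (T := [set 1]) => //.
- by move=> x y -> ->; rewrite mulr1.
- by move=> x Jx x1; apply: J1; rewrite -x1.
by have [c /Jlep] := Jp p.
Qed.

Lemma prime_notM (p : Spec R) x y :
  ~ (p : set R) x -> ~ (p : set R) y -> ~ (p : set R) (x * y).
Proof. by move=> px py /prime_mul[]. Qed.

End PrimeAvoidance.

(* Elementwise form of: R_p -> S (x)_R R_p is bijective.                      *)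
Definition local_iso_at (R S : comPzRingType) (f : {rmorphism R -> S})
    (p : Spec R) : Prop :=
  (forall a, f a = 0 -> exists2 c, ~ (p : set R) c & c * a = 0) /\
  (forall s, exists2 c, ~ (p : set R) c & exists r, f c * s = f r).

(** * Open immersions are isomorphisms on local rings *)

Section OpenImmersionLocal.
Variables (R S : comPzRingType) (f : {rmorphism R -> S}).

Lemma const_section (A : comPzRingType) (W : set (Spec A)) (a : A) :
  open W -> is_section (fun p (_ : W p) => loc_frac a (denom1 p)).
Proof.
move=> Wo p Wp; exists W; split=> //; exists a, 1 => q Wq _.
by exists (denom1_subproof q); congr loc_frac; exact: val_inj.
Qed.

Lemma open_generization (A : comPzRingType) (W : set (Spec A)) (p q : Spec A) :
  open W -> W p -> q `<=` p -> W q.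
Proof.
move=> [E ->] [x Ex px] qp; exists x => //.
by move=> /qp.
Qed.

(** Elements of S are sections over Spec S, so the sheaf condition lifts them uniquely to the open
    image [W]. Uniqueness gives injectivity at the prime; writing the lift locally as a fraction a /
    b gives surjectivity. *)
Lemma open_immersion_local_iso (q : Spec S) :
  open_immersion f -> local_iso_at f (spec_map f q).
Proof.
case=> _ fc fo fsheaf; pose W := range (spec_map f).
have Wo : open W by apply: fo; exact: openT.
have fWo : open (spec_map f @^-1` W) by move/continuousP: fc; apply.
have Wf q' : W (spec_map f q') by exists q'.
have sheafW s := fsheaf W Wo (@subset_refl _ _) _ (const_section s fWo).
split=> [a fa0|s].
- have [s0 [_ s0u]] := sheafW 0.
  (* Every element of the kernel of f lifts the zero section, so [a] and 0 have the same germ. *)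
  have E b : f b = 0 -> s0 = fun p _ => loc_frac b (denom1 p).
    move=> fb0; apply: s0u; split; first exact: const_section.
    move=> q' _; rewrite loc_map_frac fb0.
    by apply/loc_fracP; exists (denom1 _); rewrite /= !mul0r.
  have := E a fa0; rewrite (E 0 (rmorph0 f)).
  move=> /(congr1 (fun s : forall p, W p -> loc p => s _ (Wf q))).
  move=> /loc_fracP[u /=]; rewrite mul0r mulr0 mulr1 => ua0.
  by exists (val u) => //; exact: (denomP u).
have [sigma [[sigma_sec sigmaE] _]] := sheafW s.
have [W' [W'o W'q W'W [a [b abE]]]] := sigma_sec _ (Wf q).
(* [J] is the annihilator of f(b) s - f(a). An element of [J] of the form f(c), with c outside the
   prime of R, is the multiplier sought. *)
pose J := [set y : S | y * (f b * s) = y * f a].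
(* A prime avoiding T lies over a generization of [spec_map f q], hence in W'. *)
pose T := f @` (~` (spec_map f q : set R)).
have [[y Jy [c qc yE]]|JT] := pselect (exists2 y, J y & T y).
  exists (c * b); last by exists (c * a); rewrite !rmorphM -mulrA yE.
  have [bq _] := abE _ (Wf q) W'q.
  apply: prime_notM => //; rewrite notin_setE in bq; exact: bq.
have [||||q' [Jq' Tq']] := @prime_avoiding S J T.
- split=> [|x y Jx Jy|r x Jx]; rewrite /J /= ?mul0r //.
  + by rewrite !mulrDl Jx Jy.
  + by rewrite -!mulrA Jx.
- by exists 1; rewrite ?rmorph1 //; exact: prime_proper.
- move=> _ _ [x px <-] [y py <-]; exists (x * y); last by rewrite rmorphM.
  exact: prime_notM.
- by move=> y Jy Ty; apply: JT; exists y.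
have W'q' : W' (spec_map f q').
  apply: open_generization W'o W'q _ => x q'x.
  by apply: contrapT => qx; apply: (Tq' (f x)) => //; exists x.
have [bq sE] := abE _ (Wf q') W'q'.
(* At q' the germ of s equals f(a) / f(b), so some element outside q' lies in [J], although q'
   contains [J]. *)
have := sigmaE q' (Wf q'); rewrite sE loc_map_frac => /loc_fracP[u /=].
rewrite mulr1 => uE; exfalso.
apply: (denomP u); apply: Jq'; rewrite /J /= uE.
by rewrite [s * _]mulrC.
Qed.

End OpenImmersionLocal.

Lemma bc_pure0 (R S : comPzRingType) (f : {rmorphism R -> S}) (U : lmodType R)
  (s : S) : bc_pure f s 0 = 0 :> basechange f U.
Proof. by apply: (addIr (bc_pure f s 0)); rewrite -bc_pureDr !add0r. Qed.

(** * Comparing Z with S (x) Z near a prime *)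

Section LocalInjectivity.
Variables (R S : comPzRingType) (f : {rmorphism R -> S}) (p : Spec R).
Hypothesis fp : local_iso_at f p.
Variable Z : lmodType R.
Implicit Types (x y : seq (ralg f * Z)) (z w : Z).

(* In terms of localizations: w / c is the image of x under the map           *)
(* S (x)_R Z -> Z_p.                                                          *)
Inductive clears (c : R) : seq (ralg f * Z) -> Z -> Prop :=
| clears_nil : clears c [::] 0
| clears_cons (s : S) z x r w :
    f c * s = f r -> clears c x w -> clears c ((s, z) :: x) (r *: z + w).

Definition eq_near w w' := exists2 d, ~ (p : set R) d & d *: w = d *: w'.

Lemma eq_near_refl w : eq_near w w.
Proof. by exists 1 => //; exact: prime_proper. Qed.

Lemma eq_near_sym w w' : eq_near w w' -> eq_near w' w.
Proof. by case=> d pd ww'; exists d. Qed.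

Lemma eq_near_trans w' w w'' :
  eq_near w w' -> eq_near w' w'' -> eq_near w w''.
Proof.
move=> [d pd E] [d' pd' E']; exists (d' * d); first exact: prime_notM.
by rewrite -scalerA E scalerA mulrC -scalerA E' scalerA.
Qed.

Lemma eq_near_add w1 w1' w2 w2' :
  eq_near w1 w1' -> eq_near w2 w2' -> eq_near (w1 + w2) (w1' + w2').
Proof.
move=> [d pd E] [d' pd' E']; exists (d * d'); first exact: prime_notM.
by rewrite !scalerDr {1 3}[d * d']mulrC -!scalerA E E'.
Qed.

Lemma eq_near_cancel c w w' :
  ~ (p : set R) c -> eq_near (c *: w) (c *: w') -> eq_near w w'.
Proof.
move=> pc [d pd E]; exists (d * c); first exact: prime_notM.
by rewrite -!scalerA.
Qed.

Lemma eq_near_coef r r' z : f r = f r' -> eq_near (r *: z) (r' *: z).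
Proof.
move=> rr'; have [|d pd dE] := fp.1 (r - r'); first by rewrite rmorphB rr' subrr.
exists d => //; apply/eqP; rewrite -subr_eq0 -scalerBr -scalerBl scalerA dE.
by rewrite scale0r.
Qed.

Lemma clears_scale d c x w : clears c x w -> clears (d * c) x (d *: w).
Proof.
elim=> [|s z y r v E _ IH]; first by rewrite scaler0; constructor.
by rewrite scalerDr scalerA; constructor=> //; rewrite !rmorphM -E mulrA.
Qed.

Lemma clears_exists x : exists2 c, ~ (p : set R) c & exists w, clears c x w.
Proof.
elim: x => [|[s z] x [c pc [w xw]]].
  by exists 1; [exact: prime_proper|exists 0; constructor].
have [d pd [r ds]] := fp.2 s.
exists (d * c); first exact: prime_notM.
exists ((c * r) *: z + d *: w); constructor; last exact: clears_scale.
by rewrite !rmorphM -ds mulrCA mulrA.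
Qed.

Lemma clears_consE c s z x w : clears c ((s, z) :: x) w ->
  exists r v, [/\ f c * (s : S) = f r, clears c x v & w = r *: z + v].
Proof.
by move=> H; inversion H; subst; exists r, w0.
Qed.

Lemma clears_nilE c w : clears c [::] w -> w = 0.
Proof. by move=> H; inversion H. Qed.

Lemma clears_catE c x y w : clears c (x ++ y) w ->
  exists w1 w2, [/\ clears c x w1, clears c y w2 & w = w1 + w2].
Proof.
elim: x w => [|[s z] x IHx] w /=.
  by exists 0, w; split; rewrite ?add0r //; constructor.
move=> /clears_consE[r [v [rE /IHx[w1 [w2 [xw1 yw2 ->]]] ->]]].
by exists (r *: z + w1), w2; split; rewrite ?addrA //; constructor.
Qed.

Lemma clears_uniq c x w w' : clears c x w -> clears c x w' -> eq_near w w'.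
Proof.
elim: x w w' => [|[s z] x IHx] w w'.
  by move=> /clears_nilE-> /clears_nilE->; exact: eq_near_refl.
move=> /clears_consE[r [v [rE xv ->]]] /clears_consE[r' [v' [r'E xv' ->]]].
apply: eq_near_add; last exact: IHx.
by apply: eq_near_coef; rewrite -rE.
Qed.

(** This makes the map S (x) Z -> Z_p well defined: each generating relation of the tensor product
    preserves the cleared value up to a multiplier outside p. *)
Lemma tens_rel_clears x y : tens_rel x y ->
  forall c w w', clears c x w -> clears c y w' -> eq_near w w'.
Proof.
elim=> {x y}.
- by move=> x c w w'; exact: clears_uniq.
- by move=> x y _ IH c w w' xw yw'; apply/eq_near_sym/(IH c).
- move=> y x z _ IHxy _ IHyz c w w' xw zw'.
  (* The multiplier [c] need not clear the middle term [y], so [y] gets its own [d], and the values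
     are compared over c d. *)
  have [d pd [v yv]] := clears_exists y.
  have yv' := clears_scale c yv.
  apply: (eq_near_cancel pd); apply: (@eq_near_trans (c *: v)).
    by apply: (IHxy (d * c)); [exact: clears_scale|rewrite mulrC].
  by apply: (IHyz (c * d)) => //; rewrite mulrC; exact: clears_scale.
- move=> x x' y y' _ IHx _ IHy c w w' /clears_catE[w1 [w2 [xw1 yw2 ->]]].
  move=> /clears_catE[w1' [w2' [xw1' yw2' ->]]].
  by apply: eq_near_add; [exact: (IHx c)|exact: (IHy c)].
- move=> x y c w w' /clears_catE[w1 [w2 [xw1 yw2 ->]]].
  move=> /clears_catE[w1' [w2' [yw1' xw2' ->]]]; rewrite addrC.
  by apply: eq_near_add; apply: clears_uniq; eassumption.
- move=> z c w w' /clears_consE[r [v [rE /clears_nilE-> ->]]] /clears_nilE->.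
  rewrite addr0 -(scale0r z); apply: eq_near_coef.
  by rewrite -rE [f c * _]mulr0 rmorph0.
- move=> s s' z c w w' /clears_consE[r [v [rE /clears_nilE-> ->]]].
  move=> /clears_consE[r1 [v1 [r1E s'v1 ->]]].
  have [r2 [_ [r2E /clears_nilE-> ->]]] := clears_consE s'v1.
  rewrite !addr0 -scalerDl; apply: eq_near_coef.
  by rewrite -rE rmorphD -r1E -r2E -mulrDr.
- move=> s z z' c w w' /clears_consE[r [v [rE /clears_nilE-> ->]]].
  move=> /clears_consE[r1 [v1 [r1E s'v1 ->]]].
  have [r2 [_ [r2E /clears_nilE-> ->]]] := clears_consE s'v1.
  rewrite !addr0 scalerDr.
  by apply: eq_near_add; apply: eq_near_coef; rewrite -rE.
- move=> a s z c w w' /clears_consE[r [v [rE /clears_nilE-> ->]]].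
  move=> /clears_consE[r1 [_ [r1E /clears_nilE-> ->]]].
  rewrite !addr0 scalerA; apply: eq_near_coef.
  by rewrite -rE ralg_scaleE mulrCA r1E rmorphM mulrC.
Qed.

Lemma bc_unit_inj z :
  bc_pure f 1 z = 0 -> exists2 d, ~ (p : set R) d & d *: z = 0.
Proof.
move=> /eqP/tensor_piP zR.
have [|d pd] := tens_rel_clears zR (c := 1) (w := 1 *: z + 0) _ (clears_nil 1).
  by constructor; [rewrite mulr1|constructor].
by rewrite scale1r addr0 scaler0; exists d.
Qed.

Lemma bc_clear (x : basechange f Z) :
  exists2 c, ~ (p : set R) c & exists w, f c *: x = bc_pure f 1 w.
Proof.
elim/tensor_ind: x => [|s z|x y [c pc [w xw]] [d pd [v yv]]].
- exists 1; first exact: prime_proper.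
  by exists 0; rewrite scaler0 bc_pure0.
- have [c pc [r sr]] := fp.2 s; exists c => //; exists (r *: z).
  by rewrite [pure _ _]/(bc_pure f s z) bc_scaleE sr -bc_pureZ mulr1.
- exists (c * d); first exact: prime_notM.
  exists (d *: w + c *: v); rewrite bc_pureDr -!bc_pureZ -!bc_scaleE -xw -yv.
  by rewrite scalerDr !scalerA rmorphM [f d * _]mulrC.
Qed.

End LocalInjectivity.

(** * Comparison on overlaps *)

Definition restr (R S : comPzRingType) (f : {rmorphism R -> S})
  (M : lmodType S) : Type := M.

Section Restriction.
Variables (R S : comPzRingType) (f : {rmorphism R -> S}) (M : lmodType S).

HB.instance Definition _ := GRing.Zmodule.copy (restr f M) M.

Definition restr_scale (r : R) (m : restr f M) : restr f M := f r *: (m : M).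

Fact restr_scaleA a b v :
  restr_scale a (restr_scale b v) = restr_scale (a * b) v.
Proof. by rewrite /restr_scale scalerA rmorphM. Qed.

Fact restr_scale1 : left_id 1 restr_scale.
Proof. by move=> v; rewrite /restr_scale rmorph1 scale1r. Qed.

Fact restr_scaleDr : right_distributive restr_scale +%R.
Proof. by move=> a u v; rewrite /restr_scale scalerDr. Qed.

Fact restr_scaleDl v : {morph restr_scale^~ v : a b / a + b}.
Proof. by move=> a b; rewrite /restr_scale rmorphD scalerDl. Qed.

HB.instance Definition _ := GRing.Zmodule_isLmodule.Build R (restr f M)
  restr_scaleA restr_scale1 restr_scaleDr restr_scaleDl.

Lemma restr_scaleE (r : R) (m : restr f M) : r *: m = f r *: (m : M).
Proof. by []. Qed.

End Restriction.

Section Overlap.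
Variables (R S T : comPzRingType).
Variables (f : {rmorphism R -> S}) (g : {rmorphism R -> T}) (V : lmodType R).
Local Notation Z := (restr g (basechange g V)).

Definition unfold_scalars (x : tring f g) (v : V) : basechange f Z :=
  tens_lift (fun (s : ralg f) (t : ralg g) =>
    bc_pure f s (bc_pure g t v : Z) : basechange f Z) x.

Lemma unfold_scalars_balanced v :
  balanced (fun (s : ralg f) (t : ralg g) =>
    bc_pure f s (bc_pure g t v : Z) : basechange f Z).
Proof.
split=> [s s' t|s t t'|r s t].
- by rewrite bc_pureDl.
- by rewrite bc_pureDl bc_pureDr.
- by rewrite !ralg_scaleE bc_pureZ restr_scaleE bc_scaleE.
Qed.

Lemma unfold_scalars_pure s t v :
  unfold_scalars (tr_pure f g s t) v = bc_pure f s (bc_pure g t v : Z).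
Proof. exact: (tens_lift_pure (unfold_scalars_balanced v)). Qed.

Lemma unfold_scalarsD v : {morph unfold_scalars^~ v : x y / x + y}.
Proof. exact: (tens_liftD (unfold_scalars_balanced v)). Qed.

Lemma unfold_scalars0 v : unfold_scalars 0 v = 0.
Proof. exact: (tens_lift0 (unfold_scalars_balanced v)). Qed.

Lemma unfold_balanced :
  balanced (fun (x : ralg (tr_base f g)) (v : V) => unfold_scalars x v).
Proof.
split=> [x x' v|x v v'|r x v]; first exact: unfold_scalarsD.
- elim/tensor_ind: x => [|s t|x y IHx IHy].
  + by rewrite !unfold_scalars0 addr0.
  + by rewrite !unfold_scalars_pure bc_pureDr [LHS]bc_pureDr.
  + by rewrite !unfold_scalarsD IHx IHy addrACA.
- elim/tensor_ind: x => [|s t|x y IHx IHy].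
  + by rewrite scaler0 !unfold_scalars0.
  + rewrite ralg_scaleE -tr_inr_base [_ * _]tr_pureM mul1r.
    by rewrite !unfold_scalars_pure bc_pureZ.
  + by rewrite scalerDr !unfold_scalarsD IHx IHy.
Qed.

(* (S (x)_R T) (x)_R V -> S (x)_R (T (x)_R V)                                 *)
Definition unfold : basechange (tr_base f g) V -> basechange f Z :=
  tens_lift (fun (x : ralg (tr_base f g)) (v : V) => unfold_scalars x v).

Lemma unfold_inr (x : basechange g V) :
  unfold (bc_map (tr_inr_base f g) x) = bc_pure f 1 (x : Z).
Proof.
elim/tensor_ind: x => [|t v|x y IHx IHy].
- by rewrite bc_map0 bc_pure0; exact: (tens_lift0 unfold_balanced).
- rewrite bc_map_pure -[RHS]unfold_scalars_pure.
  exact: (tens_lift_pure unfold_balanced).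
- rewrite bc_mapD [X in _ = X]bc_pureDr -IHx -IHy.
  exact: (tens_liftD unfold_balanced).
Qed.

(** Under [unfold] the map from T (x) V to the overlap becomes the unit map of the R-module T (x) V,
    to which [bc_unit_inj] applies. *)
Lemma bc_inr_inj (p : Spec R) (x y : basechange g V) :
  local_iso_at f p ->
  bc_map (tr_inr_base f g) x = bc_map (tr_inr_base f g) y ->
  exists2 d, ~ (p : set R) d & g d *: x = g d *: y.
Proof.
move=> fp /(congr1 unfold); rewrite !unfold_inr => xy.
have [|d pd dE] := bc_unit_inj fp (z := (x - y : Z)).
  apply: (addIr (bc_pure f 1 (y : Z))); rewrite -bc_pureDr subrK add0r.
  exact: xy.
exists d => //; apply/eqP; rewrite -subr_eq0 -scalerBr; exact/eqP.
Qed.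

End Overlap.

(** * Descent of elements along the covering *)

Section Gluing.
Variables (R : comPzRingType) (n : nat) (S : 'I_n -> comPzRingType).
Variable phi : forall l, {rmorphism R -> S l}.
Hypothesis phi_local : forall p : Spec R, exists l, local_iso_at (phi l) p.
Variable V : lmodType R.

Lemma section_inj (v w : V) :
  (forall l, bc_pure (phi l) 1 v = bc_pure (phi l) 1 w) -> v = w.
Proof.
move=> vw; pose J := [set e : R | e *: v = e *: w].
suff : J 1 by rewrite /J /= !scale1r.
apply: ideal_full => [|p].
  split=> [|x y Jx Jy|r x Jx]; rewrite /J /= ?scale0r //.
    by rewrite !scalerDl Jx Jy.
  by rewrite -!scalerA Jx.
have [l lp] := phi_local p.
have [|d pd dE] := bc_unit_inj lp (z := v - w).
  apply: (addIr (bc_pure (phi l) 1 w)); rewrite -bc_pureDr subrK add0r.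
  exact: vw.
by exists d => //; apply/eqP; rewrite -subr_eq0 -scalerBr dE.
Qed.

Lemma section_glue (v : forall l, basechange (phi l) V) :
  (forall l j, bc_map (tr_inl_base (phi l) (phi j)) (v l) =
               bc_map (tr_inr_base (phi l) (phi j)) (v j)) ->
  exists w, forall l, v l = bc_pure (phi l) 1 w.
Proof.
move=> vE.
pose J := [set e | exists w, forall l, phi l e *: v l = bc_pure (phi l) 1 w].
suff [w wE] : J 1 by exists w => l; rewrite -wE rmorph1 scale1r.
apply: ideal_full => [|p].
  split=> [|x y [w wE] [w' w'E]|r x [w wE]].
  - by exists 0 => l; rewrite rmorph0 scale0r bc_pure0.
  - by exists (w + w') => l; rewrite rmorphD scalerDl wE w'E bc_pureDr.
  - by exists (r *: w) => l; rewrite rmorphM -scalerA wE bc_scaleE bc_pureZ.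
have [l lp] := phi_local p.
have [c pc [w wE]] := bc_clear lp (v l).
(* On the overlap of l and j, c v_j becomes c v_l, which is the image of [w]; hence c v_j and [w]
   agree up to a multiplier depending on [j]. *)
have near j : {d | ~ (p : set R) d &
    phi j d *: (phi j c *: v j) = phi j d *: bc_pure (phi j) 1 w}.
  apply: cid2; apply: (bc_inr_inj lp).
  rewrite bc_mapZ -vE bc_map_pure rmorph1.
  rewrite /= (tr_inr_base (phi l) (phi j) c) -(tr_inl_base (phi l) (phi j)).
  by rewrite -(bc_mapZ (tr_inl_base (phi l) (phi j))) wE bc_map_pure rmorph1.
(* Finiteness of the covering yields one multiplier for all j; it stays outside p because p is
   prime. *)
pose d := \prod_j s2val (near j).
exists (d * c); last first.
  apply: prime_notM => //; rewrite /d.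
  apply: (big_ind (fun x => ~ (p : set R) x)); first exact: prime_proper.
    by move=> x y; exact: prime_notM.
  by move=> j _; exact: (s2valP (near j)).
exists (d *: w) => j.
rewrite rmorphM -scalerA -bc_pureZ -bc_scaleE /d (bigD1 j) //= mulrC rmorphM.
by rewrite -!scalerA (s2valP' (near j)).
Qed.

End Gluing.

(** * The ordinal filtration and its local nature *)

Section Filtration.
Variables (d : Order.disp_t) (O : orderType d).
Hypothesis O_wf : well_founded (fun x y : O => (x < y)%O).

Lemma quite_filt_posE (R : comPzRingType) (U V : lmodType R) (a b : O)
    (e : U -> V) (r : R) :
  (b < a)%O -> quite_filt a e ->
  exists2 c, (c < a)%O & quite_filt c (bimod_comm r e).
Proof.
move=> ba ea; case: ea ba => {}a {}e; last by move=> _ ea _; exact: ea.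
by move=> amin _ ba; have := amin b; rewrite ba.
Qed.

Lemma quite_filt_zeroE (R : comPzRingType) (U V : lmodType R) (a : O)
    (e : U -> V) :
  ~ (exists b, (b < a)%O) -> quite_filt a e -> forall r u, bimod_comm r e u = 0.
Proof. by move=> amin ea; case: ea amin => {}a {}e // aex _ []. Qed.

(** The zero map is again a bimodule map, so well-founded induction applies to the commutators. *)
Lemma quite_filt_bimodule_map (R : comPzRingType) (U V : lmodType R) (a : O)
    (e : U -> V) :
  (forall r, bimod_comm r e = fun _ => 0) -> quite_filt a e.
Proof.
have comm0 r : bimod_comm r (fun _ : U => 0 : V) = fun _ => 0.
  by apply/funext => u; rewrite /bimod_comm scaler0 subrr.
elim/(well_founded_ind O_wf): a e => a IHa e e0.
have [[b ba]|amin] := pselect (exists b : O, (b < a)%O).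
  apply: quite_filt_pos; first by exists b.
  by move=> r; exists b => //; rewrite e0; exact: IHa.
apply: quite_filt_zero => [b|r u]; last by rewrite e0.
by apply/negP => ba; apply: amin; exists b.
Qed.

Lemma quite_filt_lt (R : comPzRingType) (U V : lmodType R) (a b : O)
    (e : U -> V) :
  (a < b)%O -> quite_filt a e -> quite_filt b e.
Proof.
move=> ab ea; case: ea ab => {}a {}e.
  move=> _ e0 _; apply: quite_filt_bimodule_map => r.
  by apply/funext => u; exact: e0.
move=> _ ea ab; apply: quite_filt_pos; first by exists a.
by move=> r; have [c ca ?] := ea r; exists c => //; exact: lt_trans ab.
Qed.

Lemma quite_filt_le (R : comPzRingType) (U V : lmodType R) (a b : O)
    (e : U -> V) :
  (a <= b)%O -> quite_filt a e -> quite_filt b e.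
Proof. by rewrite le_eqVlt => /predU1P[->//|]; exact: quite_filt_lt. Qed.

Variables (R : comPzRingType) (n : nat) (S : 'I_n -> comPzRingType).
Variable phi : forall l, {rmorphism R -> S l}.
Hypothesis phi_local : forall p : Spec R, exists l, local_iso_at (phi l) p.
Variables U V : lmodType R.

(** The commutator of [E l] with the image of r restricts to that of [e] with r, so the induction
    runs on commutators; at the least ordinal they vanish by [section_inj]. *)
Lemma quite_filt_local (a : O) (e : U -> V)
    (E : forall l, basechange (phi l) U -> basechange (phi l) V) :
  (forall l u, E l (bc_pure (phi l) 1 u) = bc_pure (phi l) 1 (e u)) ->
  (forall l, quite_filt a (E l)) -> quite_filt a e.
Proof.
elim/(well_founded_ind O_wf): a e E => a IHa e E Ee Ea.
have commE r l u : bimod_comm (phi l r) (E l) (bc_pure (phi l) 1 u) =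
    bc_pure (phi l) 1 (bimod_comm r e u).
  apply: (addIr (bc_pure (phi l) 1 (e (r *: u)))); rewrite -bc_pureDr subrK.
  by rewrite /bimod_comm bc_scaleE bc_pureZ !Ee subrK bc_scaleE bc_pureZ.
have [[b ba]|amin] := pselect (exists b : O, (b < a)%O).
  apply: quite_filt_pos; first by exists b.
  move=> r.
  have near l : {c | (c < a)%O & quite_filt c (bimod_comm (phi l r) (E l))}.
    exact/cid2/(quite_filt_posE _ ba).
  (* A maximum of finitely many elements below [a] is still below [a]; the default [b] keeps this
     true for an empty family. *)
  pose c := \big[Order.max/b]_l s2val (near l).
  have ca : (c < a)%O.
    apply: (big_ind (fun c => (c < a)%O)) => // [x y xa ya|l _].
      by rewrite gt_max xa.
    exact: (s2valP (near l)).
  exists c => //; apply: (IHa c ca _ (fun l => bimod_comm (phi l r) (E l))) => l.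
    exact: commE.
  apply: quite_filt_le (s2valP' (near l)).
  by rewrite /c (bigD1 l) //= le_max lexx.
apply: quite_filt_zero => [b|r u].
  by apply/negP => ba; apply: amin; exists b.
apply: (section_inj phi_local) => l; rewrite -commE bc_pure0.
exact: (quite_filt_zeroE amin (Ea l)).
Qed.

End Filtration.

(** * Assembling the operator *)

Lemma bc_map_swap_inr (R S T : comPzRingType) (f : {rmorphism R -> S})
    (g : {rmorphism R -> T}) (V : lmodType R) (x : basechange g V) :
  bc_map (tr_swap_base f g) (bc_map (tr_inr_base f g) x) =
  bc_map (tr_inl_base g f) x.
Proof.
elim/tensor_ind: x => [|t v|x y IHx IHy].
- by rewrite !bc_map0.
- by rewrite !bc_map_pure /= tr_swap_pure.
- by rewrite !bc_mapD IHx IHy.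
Qed.

(** Evaluating the defining equation of the induced operator at 1 (x) (1 (x) u) reduces the overlap
    hypothesis to an equation between elements. *)
Lemma induced_tower_unit (K R S T : comPzRingType) (kappa : {rmorphism K -> R})
    (f : {rmorphism R -> S}) (g : {rmorphism S -> T}) (h : {rmorphism R -> T})
    (gf : forall r, g (f r) = h r) (U V : lmodType R)
    (D : basechange f U -> basechange f V)
    (D' : basechange h U -> basechange h V) (u : U) :
  induced_tower kappa gf D D' ->
  D' (bc_pure h 1 u) = bc_map gf (D (bc_pure f 1 u)).
Proof.
case=> D'' [_ _ D''E] D'E.
have := D'E (bc_pure g 1 (bc_pure f 1 u)).
rewrite D''E bc_assoc_pure mul1r rmorph1 => ->.
by rewrite -[RHS]scale1r; exact: (tens_lift_pure (bc_assoc_balanced gf V)).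
Qed.

Theorem proposition6p8
  (K R : comPzRingType) (kappa : {rmorphism K -> R})
  (n : nat) (S : 'I_n -> comPzRingType)
  (phi : forall l : 'I_n, {rmorphism R -> S l})
  (hcov : affine_open_covering phi)
  (alpha : wordinal)
  (U V : lmodType R)
  (D : forall l : 'I_n, basechange (phi l) U -> basechange (phi l) V)
  (hD : forall l : 'I_n, quite_diffop_le (phi l \o kappa) alpha (D l))
  (* D2 j l is the operator D_jl on S_jl = S_j (x)_R S_l induced by D_l *)
  (D2 : forall j l : 'I_n, basechange (tr_base (phi j) (phi l)) U ->
                           basechange (tr_base (phi j) (phi l)) V)
  (hD2 : forall j l : 'I_n,
    induced_tower kappa (tr_inr_base (phi j) (phi l)) (D l) (D2 j l))
  (hswap : forall (j l : 'I_n) (x : basechange (tr_base (phi j) (phi l)) U),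
    bc_map (tr_swap_base (phi j) (phi l)) (D2 j l x) =
    D2 l j (bc_map (tr_swap_base (phi j) (phi l)) x)) :
  exists! D0 : U -> V,
    quite_diffop_le kappa alpha D0 /\
    forall l : 'I_n, induced kappa D0 (D l).
Proof.
have phi_local p : exists l, local_iso_at (phi l) p.
  have [phi_open phi_cover] := hcov.
  have [l _ [q _ <-]] : (\bigcup_l range (spec_map (phi l))) p.
    by rewrite phi_cover.
  by exists l; exact: open_immersion_local_iso.
have glued u : exists w, forall l,
    D l (bc_pure (phi l) 1 u) = bc_pure (phi l) 1 w.
  apply: (section_glue phi_local) => l j.
  (* Both sides are values at 1 (x) u of induced operators on the overlap, in its two orders;
     [hswap] identifies them. *)
  rewrite -bc_map_swap_inr -(induced_tower_unit u (hD2 j l)) hswap bc_map_pure.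
  by rewrite rmorph1 (induced_tower_unit u (hD2 l j)).
have [D0 D0E] := choice glued.
(* [D0] comes from a pointwise choice, but its values are determined in every S_l (x) V, where
   linearity of D_l applies. *)
have D0K : Klinear kappa D0.
  move=> k u u'; apply: (section_inj phi_local) => l.
  rewrite -D0E !bc_pureDr -!bc_pureZ -!bc_scaleE.
  by rewrite ((hD l).1 k) !D0E.
have D0a : quite_filt (ord_elt alpha) D0.
  apply: (quite_filt_local (@ord_wf alpha) phi_local (E := D)) => [l u|l].
    exact: D0E.
  by have [] := hD l.
exists D0; split=> [|D1 [_ D1E]].
  split=> // l; split=> [||u]; first by exists alpha.
    by exists alpha.
  exact: D0E.
apply/funext => u; apply: (section_inj phi_local) => l.
by have [_ _ <-] := D1E l; rewrite D0E.
Qed.
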